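(* Consider the gradient-descent approximate policy iteration sequence described in the context. Suppose that $\gamma>0$ is such that $\alpha_{GD,\gamma}<1$, that $m+H-1>\log(2\delta_{FV})/\log(1/\alpha)$ (with $\delta_{FV}<\infty$), and that $$\eta>\frac{\log\big(3\sqrt{|S|}\,\|\Phi\|_\infty/\sigma_{\min,\Phi}\big)}{\log(1/\alpha_{GD,\gamma})}.$$ Let $c:=\frac{\sqrt{|S|}\,\|\Phi\|_\infty}{\sigma_{\min,\Phi}}$ and define $$\beta:=\alpha^{m+H-1}\delta_{FV}+c\,\alpha_{GD,\gamma}^\eta(\alpha^{m+H-1}\delta_{FV}+1),$$ $$\tau:=(1+c\,\alpha_{GD,\gamma}^\eta)\Big(\frac{\alpha^m+\alpha^{m+H-1}}{1-\alpha}\delta_{FV}+\delta_{app}+\delta_{FV}\epsilon_{PE}\Big)+\frac{c\,\alpha_{GD,\gamma}^\eta}{1-\alpha}.$$ Then $\beta<1$ and for every $k\ge1$, $$\|J^{\mu_k}-J^*\|_\infty\le\frac{\alpha^{kH}}{1-\alpha}+\frac{2\alpha^H\|J^{\mu_0}-J_0\|_\infty}{1-\alpha}\,k\,\max(\alpha^H,\beta)^{k-1}+\frac{2\alpha^H\frac{\tau}{1-\beta}+\epsilon_{LA}}{(1-\alpha^H)(1-\alpha)}.$$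
   Context: Consider a Markov decision process with finite state space $S$ (with $|S|$ states), finite action space $A$, transition probabilities $P_{ij}(a)$, rewards $r(s,a)\in[0,1]$, and discount factor $\alpha\in(0,1)$. A (deterministic stationary) policy is a map $\mu:S\to A$; its value is $J^\mu(s)=E[\sum_{t\ge0}\alpha^t r(s_t,\mu(s_t))\mid s_0=s]$, and $J^*(s)=\max_\mu J^\mu(s)$. For a policy $\mu$, $(T_\mu J)(s)=r(s,\mu(s))+\alpha\sum_j P_{sj}(\mu(s))J(j)$; the Bellman operator is $(TJ)(s)=\max_{a\in A}\{r(s,a)+\alpha\sum_j P_{sj}(a)J(j)\}$; powers denote repeated application. $\|\cdot\|_\infty$ denotes the max norm and the induced matrix norm; $\|\cdot\|_2$ the Euclidean norm. Gradient-descent approximate policy iteration: fix integers $m\ge1$, $H\ge1$, $\eta\ge1$, a step size $\gamma>0$, constants $\epsilon_{LA},\epsilon_{PE}\ge0$, a feature matrix $\Phi\in\mathbb{R}^{|S|\times d}$ whose row $i$ is $\phi(i)^\top$, and subsets $D_k\subseteq S$ ($k\ge0$) such that $\{\phi(i)\}_{i\in D_k}$ has rank $d$. Let $\Phi_{D_k}$ be the submatrix of $\Phi$ with rows indexed by $D_k$, $P_k\in\{0,1\}^{|D_k|\times|S|}$ the matrix selecting the coordinates in $D_k$, and $\mathcal{M}_{k+1}:=\Phi(\Phi_{D_k}^\top\Phi_{D_k})^{-1}\Phi_{D_k}^\top P_k$. Start with $\theta_0\in\mathbb{R}^d$, $J_0=\Phi\theta_0$, and an arbitrary policy $\mu_0$.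 For each $k\ge0$: $\mu_{k+1}$ is any policy with $\|T^HJ_k-T_{\mu_{k+1}}T^{H-1}J_k\|_\infty\le\epsilon_{LA}$; $w_{k+1}\in\mathbb{R}^{|S|}$ satisfies $w_{k+1}(i)=0$ for $i\notin D_k$ and $\|w_{k+1}\|_\infty\le\epsilon_{PE}$; $\hat J_{k+1}:=T^m_{\mu_{k+1}}T^{H-1}J_k+w_{k+1}$; set $\theta_{k+1,0}=\theta_k$ and for $\ell=1,\dots,\eta$, $\theta_{k+1,\ell}=\theta_{k+1,\ell-1}-\gamma\big(\Phi_{D_k}^\top\Phi_{D_k}\theta_{k+1,\ell-1}-\Phi_{D_k}^\top P_k\hat J_{k+1}\big)$ (gradient descent on $\frac12\sum_{i\in D_k}((\Phi\theta)(i)-\hat J_{k+1}(i))^2$); then $\theta_{k+1}=\theta_{k+1,\eta}$ and $J_{k+1}=\Phi\theta_{k+1}$. Define $\delta_{FV}:=\sup_{k\ge1}\|\mathcal{M}_k\|_\infty$, $\delta_{app}:=\sup_{k\ge1}\sup_\mu\|\mathcal{M}_kJ^\mu-J^\mu\|_\infty$ (inner supremum over all policies), $\alpha_{GD,\gamma}:=\sup_{k\ge0}\max_i|1-\gamma\lambda_i(\Phi_{D_k}^\top\Phi_{D_k})|$ where $\lambda_i$ is the $i$-th eigenvalue, and $\sigma_{\min,\Phi}$ the smallest singular value of $\Phi$. *)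

(* Defs.v *)
From HB Require Import structures.
From mathcomp Require Import all_boot all_order all_algebra.
From mathcomp Require Import all_classical all_reals all_analysis.
Set Implicit Arguments. Unset Strict Implicit. Unset Printing Implicit Defensive.
Import Order.TTheory GRing.Theory Num.Theory numFieldNormedType.Exports.
Local Open Scope classical_set_scope.
Local Open Scope ring_scope.

Section MDP.
Variables (R : realType) (n : nat) (A : finType).
(* States are 'I_n; P a is the transition matrix of action a: P a i j = P_ij(a). *)
Variables (P : A -> 'M[R]_n) (r : 'I_n -> A -> R) (alpha : R).

Definition vnorm_inf (v : 'cV[R]_n) : R := \big[Num.max/0]_(i < n) `|v i 0|.

Definition Pmu (mu : 'I_n -> A) : 'M[R]_n := \matrix_(i, j) P (mu i) i j.
Definition rmu (mu : 'I_n -> A) : 'cV[R]_n := \col_i r i (mu i).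

Definition Tmu (mu : 'I_n -> A) (J : 'cV[R]_n) : 'cV[R]_n :=
  rmu mu + alpha *: (Pmu mu *m J).

(** Bellman operator: (T J)(s) = max_a { r(s,a) + alpha sum_j P_sj(a) J(j) }
    (the max of a finite set, written as its supremum) *)
Definition Tbell (J : 'cV[R]_n) : 'cV[R]_n :=
  \col_i sup [set (r i a + alpha * \sum_j P a i j * J j 0) | a in [set: A]].

(** J^mu(s) = E[ sum_t alpha^t r(s_t, mu(s_t)) | s_0 = s ]
            = sum_t alpha^t (P_mu^t r_mu)(s) *)
Definition Jmu (mu : 'I_n -> A) : 'cV[R]_n :=
  \col_i limn (series (fun t : nat => (alpha ^+ t * ((Pmu mu ^+ t *m rmu mu) i 0) : R))).

Definition Jstar : 'cV[R]_n :=
  \col_i sup (range (fun mu : 'I_n -> A => Jmu mu i 0)).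

End MDP.

Definition mxnorm_inf (R : realType) (p q : nat) (M : 'M[R]_(p, q)) : R :=
  \big[Num.max/0]_(i < p) \sum_(j < q) `|M i j|.

Section Approx.
Variables (R : realType) (n d : nat) (Phi : 'M[R]_(n, d)).

Definition selmx (D : {set 'I_n}) : 'M[R]_(#|D|, n) :=
  \matrix_(i, j) ((enum_val i == j)%:R).

Definition PhiD (D : {set 'I_n}) : 'M[R]_(#|D|, d) := selmx D *m Phi.

Definition GramD (D : {set 'I_n}) : 'M[R]_d := (PhiD D)^T *m PhiD D.

Definition Mproj (D : {set 'I_n}) : 'M[R]_n :=
  Phi *m invmx (GramD D) *m (PhiD D)^T *m selmx D.

(** one gradient step on 1/2 sum_{i in D} ((Phi theta)(i) - Jh(i))^2 *)
Definition gd_step (gamma : R) (D : {set 'I_n}) (Jh : 'cV[R]_n)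
  (theta : 'cV[R]_d) : 'cV[R]_d :=
  theta - gamma *: (GramD D *m theta - (PhiD D)^T *m (selmx D *m Jh)).

Definition sigma_min : R :=
  Num.sqrt (inf [set l | eigenvalue (Phi^T *m Phi) l]).

(** delta_FV = sup_{k>=1} ||M_k||_inf, with M_{k+1} built from D_k *)
Definition delta_FV (D : nat -> {set 'I_n}) : \bar R :=
  ereal_sup [set (mxnorm_inf (Mproj (D k)))%:E | k in [set: nat]].

Definition delta_app (A : finType) (P : A -> 'M[R]_n) (r : 'I_n -> A -> R)
  (alpha : R) (D : nat -> {set 'I_n}) : \bar R :=
  ereal_sup [set (vnorm_inf (Mproj (D k.1) *m Jmu P r alpha k.2
                              - Jmu P r alpha k.2))%:E
            | k in [set: nat * ('I_n -> A)]].

Definition alpha_GD (gamma : R) (D : nat -> {set 'I_n}) : \bar R :=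
  ereal_sup [set (`|1 - gamma * l|)%:E
            | l in [set l | exists k, eigenvalue (GramD (D k)) l]].

End Approx.

(* Main.v *)
(* Write e_k = ||J^{mu_k} - J_k|| and f_k = ||J^{mu_k} - J*||.  Gradient descent
   contracts the Euclidean distance to the least-squares solution by
   alpha_GD^eta, i.e. the sup distance of J_{k+1} to M_{k+1} Jhat_{k+1} by
   c alpha_GD^eta, which gives e_{k+1} <= beta e_k + tau; approximate policy
   improvement gives
   f_{k+1} <= alpha^H f_k + (2 alpha^H e_k + epsLA) / (1 - alpha).
   The spectral input is the Rayleigh bound for a real symmetric S: the least rho
   with x^T S x <= rho x^T x is an eigenvalue, since otherwise rho - S would be
   invertible and positive semidefinite, hence bounded below by a positive
   multiple of the identity. *)
Require Import Defs.
From HB Require Import structures.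
From mathcomp Require Import all_boot all_order all_algebra.
From mathcomp Require Import all_classical all_reals all_analysis.
From mathcomp Require Import ring lra.
Set Implicit Arguments. Unset Strict Implicit. Unset Printing Implicit Defensive.
Import Order.TTheory GRing.Theory Num.Theory numFieldNormedType.Exports.
Local Open Scope classical_set_scope.
Local Open Scope ring_scope.

(** * Euclidean inner product and spectral bounds for real symmetric matrices *)

Section RealSymmetric.
Variable R : realType.

Definition dot (n : nat) (u v : 'cV[R]_n) : R := (u^T *m v) 0 0.

Lemma dotE n (u v : 'cV[R]_n) : dot u v = \sum_i u i 0 * v i 0.
Proof. by rewrite /dot mxE; apply: eq_bigr => i _; rewrite mxE. Qed.

Lemma dotC n (u v : 'cV[R]_n) : dot u v = dot v u.
Proof. by rewrite !dotE; apply: eq_bigr => i _; rewrite mulrC. Qed.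

Lemma dotDr n (u v w : 'cV[R]_n) : dot u (v + w) = dot u v + dot u w.
Proof. by rewrite /dot mulmxDr mxE. Qed.

Lemma dotZr n (u v : 'cV[R]_n) a : dot u (a *: v) = a * dot u v.
Proof. by rewrite /dot -scalemxAr mxE. Qed.

Lemma dotDl n (u v w : 'cV[R]_n) : dot (u + v) w = dot u w + dot v w.
Proof. by rewrite !(dotC _ w) dotDr. Qed.

Lemma dotZl n (u v : 'cV[R]_n) a : dot (a *: u) v = a * dot u v.
Proof. by rewrite !(dotC _ v) dotZr. Qed.

Lemma dot_mulmxl m n (M : 'M[R]_(m, n)) u v :
  dot (M *m u) v = dot u (M^T *m v).
Proof. by rewrite /dot trmx_mul mulmxA. Qed.

Lemma dot_ge0 n (u : 'cV[R]_n) : 0 <= dot u u.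
Proof. by rewrite dotE; apply: sumr_ge0 => i _; rewrite -expr2 sqr_ge0. Qed.

Lemma dot_eq0 n (u : 'cV[R]_n) : dot u u = 0 -> u = 0.
Proof.
rewrite dotE => /psumr_eq0P u0; apply/matrixP => i j.
have /eqP := u0 (fun i _ => sqr_ge0 (u i 0)) i isT.
by rewrite mulf_eq0 orbb (ord1 j) mxE => /eqP.
Qed.

Lemma dot_gt0 n (u : 'cV[R]_n) : u != 0 -> 0 < dot u u.
Proof.
move=> u0; rewrite lt0r dot_ge0 andbT.
by apply: contra u0 => /eqP/dot_eq0 ->.
Qed.

Lemma coord_sq_le_dot n (u : 'cV[R]_n) i : u i 0 ^+ 2 <= dot u u.
Proof.
rewrite dotE (bigD1 i) //= -expr2 lerDl.
by apply: sumr_ge0 => j _; rewrite -expr2 sqr_ge0.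
Qed.

(** Each |x_i x_j| is at most (x_i^2 + x_j^2) / 2, hence at most [dot x x]. The summand 1 in the
    witness only makes [K] positive. *)
Lemma quadratic_form_bounded n (S : 'M[R]_n) :
  exists2 K, 0 < K & forall x, dot x (S *m x) <= K * dot x x.
Proof.
exists (1 + \sum_i \sum_j `|S i j|).
  by rewrite ltr_pwDl // sumr_ge0 // => i _; rewrite sumr_ge0.
move=> x; rewrite mulrDl mul1r -[leLHS]add0r lerD ?dot_ge0 //.
rewrite {1}dotE mulr_suml ler_sum // => i _.
rewrite mxE mulr_sumr mulr_suml ler_sum // => j _.
apply: le_trans (ler_norm _) _; rewrite !normrM mulrCA ler_wpM2l //.
have := coord_sq_le_dot x i; have := coord_sq_le_dot x j.
rewrite -(real_normK (num_real (x i 0))) -(real_normK (num_real (x j 0))).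
have := sqr_ge0 (`|x i 0| - `|x j 0|); lra.
Qed.

(** Since x = M^-1 (M x), it suffices to bound the form of (M^-1)^T M^-1 at M x. *)
Lemma unitmx_bounded_below n (M : 'M[R]_n) : M \in unitmx ->
  exists2 K, 0 < K & forall x, dot x x <= K * dot (M *m x) (M *m x).
Proof.
move=> Mu; have [K K0 HK] := quadratic_form_bounded ((invmx M)^T *m invmx M).
exists K => // x; have := HK (M *m x).
by rewrite -mulmxA mulKmx // -[X in _ *m X]mulmx1 mulmx1 -dot_mulmxl mulKmx.
Qed.

(* For symmetric M >= 0 bounded by K, evaluate the form at x - M x / K. *)
Lemma psd_sqnorm_le n (M : 'M[R]_n) : M^T = M ->
  (forall x, 0 <= dot x (M *m x)) ->
  exists2 K, 0 < K & forall x, dot (M *m x) (M *m x) <= K * dot x (M *m x).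
Proof.
move=> Msym Mpos; have [K K0 HK] := quadratic_form_bounded M; exists K => // x.
set y := M *m x.
have := Mpos (x - K^-1 *: y).
have -> : M *m (x - K^-1 *: y) = y - K^-1 *: (M *m y).
  by rewrite mulmxBr -scalemxAr.
rewrite -!scaleNr !(dotDr, dotDl, dotZl, dotZr).
have -> : dot x (M *m y) = dot y y by rewrite {2}/y dot_mulmxl Msym.
have := HK y.
move: (dot y (M *m y)) (dot y y) (dot x y) => c b a cb h.
have : K^-1 * K^-1 * c <= K^-1 * b.
  rewrite -mulrA ler_wpM2l ?invr_ge0 ?(ltW K0) //.
  by rewrite ler_pdivrMl.
move=> h2; have h3 : K^-1 * b <= a by lra.
by move: h3; rewrite ler_pdivrMl.
Qed.

Lemma rayleigh n (S : 'M[R]_n) : (0 < n)%N -> S^T = S ->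
  exists2 rho, eigenvalue S rho & forall x, dot x (S *m x) <= rho * dot x x.
Proof.
move=> n0 Ssym; pose E := [set t | forall x, dot x (S *m x) <= t * dot x x].
have E0 : E !=set0.
  by have [K _ HK] := quadratic_form_bounded S; exists K.
have lbE x : x != 0 -> lbound E (dot x (S *m x) / dot x x).
  by move=> x0 t /(_ x); rewrite ler_pdivrMr // dot_gt0.
(* The infimum belongs to [E] because every Rayleigh quotient is a lower bound of [E]. *)
have Einf : E (inf E).
  move=> x; have [->|x0] := eqVneq x 0.
    by rewrite mulmx0 /dot mulmx0 mxE mulr0.
  by rewrite -ler_pdivrMr ?dot_gt0 //; apply: lb_le_inf => //; exact: lbE.
exists (inf E) => //; apply: contraT.
rewrite /eigenvalue /= negbK /eigenspace kermx_eq0 /row_free.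
rewrite -mxrank_opp opprB -/(row_free _) row_free_unit.
set M := _ - S => Mu.
have Mform x : dot x (M *m x) = inf E * dot x x - dot x (S *m x).
  by rewrite mulmxBl mul_scalar_mx dotDr dotZr -scaleN1r dotZr mulN1r.
have Msym : M^T = M by rewrite linearB /= tr_scalar_mx Ssym.
have Mpos x : 0 <= dot x (M *m x) by rewrite Mform subr_ge0; exact: Einf.
have [K1 K10 HK1] := psd_sqnorm_le Msym Mpos.
have [K2 K20 HK2] := unitmx_bounded_below Mu.
(* Chaining the two bounds gives x.x <= K2 K1 (x . M x), so the supposedly least bound could still
   be lowered by 1 / (K2 K1). *)
have Ee : E (inf E - (K2 * K1)^-1).
  move=> x; rewrite mulrBl lerBrDr -lerBrDl -Mform.
  rewrite ler_pdivrMl ?mulr_gt0 // -mulrA.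
  by apply: le_trans (HK2 x) _; rewrite ler_pM2l.
have hlb : has_lbound E.
  exists (dot (delta_mx (Ordinal n0) 0) (S *m delta_mx (Ordinal n0) 0) /
     dot (delta_mx (Ordinal n0) 0) (delta_mx (Ordinal n0) 0)).
  apply: lbE; apply/eqP => /matrixP/(_ (Ordinal n0) 0).
  by rewrite !mxE !eqxx => /eqP; rewrite oner_eq0.
have := ge_inf hlb Ee.
by rewrite lerBrDr gerDl leNgt invr_gt0 mulr_gt0.
Qed.

(** The Rayleigh bound for B^2 gives |B x|^2 <= rho |x|^2 with rho an eigenvalue of B^2, say v B^2 =
    rho v. Then sqrt rho or - sqrt rho is an eigenvalue of B: if the first is not, v B - sqrt rho v
    is a nonzero eigenvector for the second. Either way rho <= a^2. *)
Lemma sym_contraction n (B : 'M[R]_n) (a : R) : B^T = B ->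
  (forall l, eigenvalue B l -> `|l| <= a) ->
  forall x, dot (B *m x) (B *m x) <= a ^+ 2 * dot x x.
Proof.
move=> Bsym Ba x; case: n B Bsym Ba x => [|n] B Bsym Ba x.
  by rewrite !dotE !big_ord0 mulr0.
have BBsym : (B *m B)^T = B *m B by rewrite trmx_mul Bsym.
have [rho /eigenvalueP[v vB v0] Hrho] := rayleigh (ltn0Sn n) BBsym.
rewrite dot_mulmxl Bsym mulmxA; apply: le_trans (Hrho x) _.
rewrite ler_wpM2r ?dot_ge0 //.
have rho0 : 0 <= rho.
  have vt0 : v^T != 0 by rewrite trmx_eq0.
  rewrite -(pmulr_lge0 _ (dot_gt0 vt0)) -dotZr -linearZ /= -vB.
  by rewrite !trmx_mul Bsym -mulmxA -{1}Bsym -dot_mulmxl dot_ge0.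
have [s|] := boolP (eigenvalue B (Num.sqrt rho)).
  rewrite -(sqr_sqrtr rho0) lerXn2r ?nnegrE ?sqrtr_ge0 //.
    exact: le_trans (normr_ge0 _) (Ba _ s).
  exact: le_trans (ler_norm _) (Ba _ s).
move=> ns; suff s : eigenvalue B (- Num.sqrt rho).
  have := Ba _ s; rewrite normrN ger0_norm ?sqrtr_ge0 // => sa.
  rewrite -(sqr_sqrtr rho0) lerXn2r ?nnegrE ?sqrtr_ge0 //.
  exact: le_trans (sqrtr_ge0 _) sa.
apply/eigenvalueP; exists (v *m B - Num.sqrt rho *: v).
  rewrite mulmxBl -mulmxA vB -scalemxAl scalerBr !scalerA mulNr -expr2.
  by rewrite sqr_sqrtr // !scaleNr opprK addrC.
apply: contra ns; rewrite subr_eq0 => /eqP vs.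
by apply/eigenvalueP; exists v.
Qed.

End RealSymmetric.

(** * Max norm and induced matrix norm *)

Section Norms.
Variable R : realType.

Lemma vnorm_inf_ge0 n (v : 'cV[R]_n) : 0 <= vnorm_inf v.
Proof.
by rewrite /vnorm_inf; elim/big_rec: _ => // i x _ x0; rewrite le_max x0 orbT.
Qed.

Lemma coord_le_vnorm_inf n (v : 'cV[R]_n) i : `|v i 0| <= vnorm_inf v.
Proof. exact: (le_bigmax _ (fun i => `|v i 0|)). Qed.

Lemma vnorm_inf_le n (v : 'cV[R]_n) c : 0 <= c ->
  (forall i, `|v i 0| <= c) -> vnorm_inf v <= c.
Proof. by move=> c0 vc; apply: bigmax_le. Qed.

Lemma ler_vnorm_infD n (u v : 'cV[R]_n) :
  vnorm_inf (u + v) <= vnorm_inf u + vnorm_inf v.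
Proof.
apply: vnorm_inf_le => [|i]; first by rewrite addr_ge0 ?vnorm_inf_ge0.
by rewrite mxE (le_trans (ler_normD _ _)) // lerD ?coord_le_vnorm_inf.
Qed.

Lemma vnorm_infN n (v : 'cV[R]_n) : vnorm_inf (- v) = vnorm_inf v.
Proof. by apply: eq_bigr => i _; rewrite mxE normrN. Qed.

Lemma vnorm_infB n (u v : 'cV[R]_n) : vnorm_inf (u - v) = vnorm_inf (v - u).
Proof. by rewrite -vnorm_infN opprB. Qed.

Lemma vnorm_inf_dist_le n (u v w : 'cV[R]_n) :
  vnorm_inf (u - w) <= vnorm_inf (u - v) + vnorm_inf (v - w).
Proof. by rewrite -(subrKA v) ler_vnorm_infD. Qed.

Lemma coord_le_dist n (u v : 'cV[R]_n) i :
  u i 0 <= v i 0 + vnorm_inf (u - v).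
Proof.
have := coord_le_vnorm_inf (u - v) i; rewrite !mxE => /(le_trans (ler_norm _)).
by rewrite lerBlDl.
Qed.

Lemma vnorm_infB_le n (u v : 'cV[R]_n) c : 0 <= c ->
  (forall i, u i 0 <= v i 0 + c) -> (forall i, v i 0 <= u i 0 + c) ->
  vnorm_inf (u - v) <= c.
Proof.
move=> c0 h1 h2; apply: vnorm_inf_le => // i; rewrite !mxE ler_norml.
by have := h1 i; have := h2 i; lra.
Qed.

Lemma mxnorm_inf_ge0 p q (M : 'M[R]_(p, q)) : 0 <= mxnorm_inf M.
Proof.
by rewrite /mxnorm_inf; elim/big_rec: _ => // i x _ x0; rewrite le_max x0 orbT.
Qed.

(** The bound [c] on the coordinates is left free so that it can be the max norm of [v] or its
    Euclidean norm. *)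
Lemma vnorm_inf_mulmx p q (M : 'M[R]_(p, q)) (v : 'cV_q) c : 0 <= c ->
  (forall j, `|v j 0| <= c) -> vnorm_inf (M *m v) <= mxnorm_inf M * c.
Proof.
move=> c0 vc; apply: vnorm_inf_le => [|i].
  by rewrite mulr_ge0 ?mxnorm_inf_ge0.
have Mi : \sum_j `|M i j| <= mxnorm_inf M.
  exact: (le_bigmax _ (fun i => \sum_j `|M i j|)).
apply: le_trans (ler_wpM2r c0 Mi); rewrite mxE mulr_suml.
apply: le_trans (ler_norm_sum _ _ _) _; apply: ler_sum => j _.
by rewrite normrM ler_wpM2l.
Qed.

End Norms.

(** * Bellman operators, policy values, and the errors of lookahead and rollout *)

Section Values.
Variables (R : realType) (n : nat) (A : finType).
Variables (P : A -> 'M[R]_n) (r : 'I_n -> A -> R) (alpha : R) (a0 : A).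
Hypothesis P_ge0 : forall a i j, 0 <= P a i j.
Hypothesis P_sum1 : forall a i, \sum_j P a i j = 1.
Hypothesis r01 : forall i a, 0 <= r i a <= 1.
Hypothesis alpha01 : 0 < alpha < 1.

Local Notation T := (Tbell P r alpha).
Local Notation Tm := (Tmu P r alpha).
Local Notation Jm := (Jmu P r alpha).
Local Notation Js := (Jstar P r alpha).

Let alpha_ge0 : 0 <= alpha. Proof. by case/andP: alpha01 => /ltW. Qed.
Let alphaB_gt0 : 0 < 1 - alpha.
Proof. by rewrite subr_gt0; case/andP: alpha01. Qed.

Definition Qval (J : 'cV[R]_n) i a := r i a + alpha * \sum_j P a i j * J j 0.

Lemma TmuE mu J i : Tm mu J i 0 = Qval J i (mu i).
Proof.
by rewrite !mxE /Qval; congr (_ + _ * _); apply: eq_bigr => j _; rewrite mxE.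
Qed.

(** This one-sided form carries both properties of the Bellman operators: monotonicity is the case c
    = 0, and two uses with c the max distance give the contraction. *)
Lemma Qval_le_add (J J' : 'cV[R]_n) c i a : (forall j, J j 0 <= J' j 0 + c) ->
  Qval J i a <= Qval J' i a + alpha * c.
Proof.
move=> JJ'; rewrite /Qval -addrA lerD2l -mulrDr ler_wpM2l //.
rewrite -[c]mul1r -(P_sum1 a i) mulr_suml -big_split /= ler_sum // => j _.
by rewrite -mulrDr ler_wpM2l.
Qed.

Lemma Tbell_attained J i :
  exists2 a, T J i 0 = Qval J i a & forall b, Qval J i b <= T J i 0.
Proof.
pose a := [arg max_(b > a0) Qval J i b]%O.
have aP b : Qval J i b <= Qval J i a.
  by rewrite /a; case: arg_maxP => // c _; exact.
have ub : ubound [set Qval J i b | b in [set: A]] (Qval J i a).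
  by move=> _ [b _ <-].
have Ta : T J i 0 = Qval J i a.
  rewrite mxE; apply/eqP; rewrite eq_le; apply/andP; split.
    by apply: ge_sup => //; exists (Qval J i a0), a0.
  by apply: ub_le_sup; [exists (Qval J i a) | exists a].
by exists a => // b; rewrite Ta.
Qed.

Lemma Tmu_le_Tbell mu J i : Tm mu J i 0 <= T J i 0.
Proof. by have [_ _] := Tbell_attained J i; rewrite TmuE; exact. Qed.

Lemma Tmu_le_add mu (J J' : 'cV[R]_n) c : (forall j, J j 0 <= J' j 0 + c) ->
  forall i, Tm mu J i 0 <= Tm mu J' i 0 + alpha * c.
Proof. by move=> JJ' i; rewrite !TmuE; exact: Qval_le_add. Qed.

Lemma Tbell_le_add (J J' : 'cV[R]_n) c : (forall j, J j 0 <= J' j 0 + c) ->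
  forall i, T J i 0 <= T J' i 0 + alpha * c.
Proof.
move=> JJ' i; have [a -> _] := Tbell_attained J i.
have [_ _ /(_ a)] := Tbell_attained J' i.
by have := Qval_le_add i a JJ'; lra.
Qed.

Lemma iter_le_add (F : 'cV[R]_n -> 'cV[R]_n) h (J J' : 'cV[R]_n) c :
  (forall (J J' : 'cV[R]_n) c, (forall j, J j 0 <= J' j 0 + c) ->
     forall i, F J i 0 <= F J' i 0 + alpha * c) ->
  (forall j, J j 0 <= J' j 0 + c) ->
  forall i, iter h F J i 0 <= iter h F J' i 0 + alpha ^+ h * c.
Proof.
move=> HF JJ'; elim: h => [|h IH] i; first by rewrite mul1r.
by rewrite exprS -mulrA; apply: HF.
Qed.

Lemma iter_contraction (F : 'cV[R]_n -> 'cV[R]_n) h (J J' : 'cV[R]_n) :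
  (forall (J J' : 'cV[R]_n) c, (forall j, J j 0 <= J' j 0 + c) ->
     forall i, F J i 0 <= F J' i 0 + alpha * c) ->
  vnorm_inf (iter h F J - iter h F J') <= alpha ^+ h * vnorm_inf (J - J').
Proof.
move=> HF; apply: vnorm_infB_le => [|i|i].
- by rewrite mulr_ge0 ?vnorm_inf_ge0 ?exprn_ge0.
- by apply: iter_le_add => // j; exact: coord_le_dist.
- by apply: iter_le_add => // j; rewrite vnorm_infB; exact: coord_le_dist.
Qed.

(* Evaluate the inequality at a coordinate where D is maximal. *)
Lemma max_principle (mu : 'I_n -> A) (D : 'I_n -> R) c :
  (forall i, D i <= alpha * (\sum_j P (mu i) i j * D j) + c) ->
  forall i, D i <= c / (1 - alpha).
Proof.
move=> HD i; pose s := [arg max_(s > i) D s]%O.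
have sP j : D j <= D s by rewrite /s; case: arg_maxP => // k _; exact.
apply: le_trans (sP i) _; rewrite ler_pdivlMr //.
have : \sum_j P (mu s) s j * D j <= D s.
  rewrite -[leRHS]mul1r -(P_sum1 (mu s) s) mulr_suml ler_sum // => j _.
  by rewrite ler_wpM2l.
by move=> /(ler_wpM2l alpha_ge0); have := HD s; lra.
Qed.

Lemma vnorm_inf_Pmu mu v : vnorm_inf (Pmu P mu *m v) <= vnorm_inf v.
Proof.
apply: vnorm_inf_le => [|i]; first exact: vnorm_inf_ge0.
rewrite mxE -[leRHS]mul1r -(P_sum1 (mu i) i) mulr_suml.
apply: le_trans (ler_norm_sum _ _ _) _; apply: ler_sum => j _.
by rewrite mxE normrM ger0_norm // ler_wpM2l // coord_le_vnorm_inf.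
Qed.

(** If v = alpha P_mu v, then |v| <= alpha |v| in the max norm, so v = 0. *)
Lemma resolvent_unitmx mu : 1%:M - alpha *: Pmu P mu \in unitmx.
Proof.
rewrite -unitmx_tr -row_free_unit; apply: inj_row_free => v.
move=> /(congr1 trmx); rewrite trmx_mul trmxK trmx0 mulmxBl mul1mx -scalemxAl.
move=> /eqP; rewrite subr_eq0 => /eqP vE.
have v0 : vnorm_inf v^T <= 0.
  have : vnorm_inf v^T <= alpha * vnorm_inf v^T.
    apply: le_trans (ler_wpM2l alpha_ge0 (vnorm_inf_Pmu mu _)).
    rewrite {1}vE; apply: vnorm_inf_le => [|i].
      by rewrite mulr_ge0 ?vnorm_inf_ge0.
    by rewrite mxE normrM ger0_norm // ler_wpM2l ?coord_le_vnorm_inf.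
  rewrite -subr_ge0 -[X in _ - X]mul1r -mulrBl nmulr_rge0 // subr_lt0.
  by case/andP: alpha01.
apply/rowP => i; have := le_trans (coord_le_vnorm_inf v^T i) v0.
by rewrite normr_le0 !mxE => /eqP.
Qed.

(** With X the solution of r_mu = X - alpha P_mu X, the discounted sum telescopes: its first N terms
    add up to X - alpha^N P_mu^N X, and the remainder is at most alpha^N |X|. *)
Lemma Jmu_resolvent mu :
  Jm mu = invmx (1%:M - alpha *: Pmu P mu) *m rmu r mu.
Proof.
set X := RHS; have rX : rmu r mu = X - alpha *: (Pmu P mu *m X).
  by rewrite scalemxAl -[X in X - _]mul1mx -mulmxBl mulKVmx // resolvent_unitmx.
move: X rX => X rX; apply/colP => i; rewrite mxE.
set u := (fun t : nat => _).
have subE (U V : 'cV[R]_n) a : (U - a *: V) i 0 = U i 0 - a * V i 0.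
  by rewrite !mxE.
have uE N : series u N = X i 0 - alpha ^+ N * (Pmu P mu ^+ N *m X) i 0.
  elim: N => [|N IH].
    by rewrite /series /= big_geq // !expr0 mul1r -[1]/(1%:M) mul1mx subrr.
  rewrite seriesSr IH /u rX mulmxBr -scalemxAr mulmxA.
  rewrite -[_ *m Pmu P mu]/(_ * _) -exprSr.
  by rewrite subE [alpha ^+ N.+1]exprSr; ring.
suff : series u @ \oo --> X i 0 by move/cvg_lim; exact.
have Pbound N : `|(Pmu P mu ^+ N *m X) i 0| <= vnorm_inf X.
  apply: le_trans (coord_le_vnorm_inf _ i) _.
  elim: N => [|N IH]; first by rewrite expr0 -[1]/(1%:M) mul1mx.
  by rewrite exprS -mulmxE -mulmxA; apply: le_trans (vnorm_inf_Pmu _ _) IH.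
have cvg0 : alpha ^+ N * vnorm_inf X @[N --> \oo] --> (0 : R).
  rewrite -[X in _ --> X](mul0r (vnorm_inf X)); apply: cvgMl.
  by apply: cvg_expr; rewrite ger0_norm //; case/andP: alpha01.
apply: (@squeeze_cvgr _ _ _ _ (fun N => X i 0 - alpha ^+ N * vnorm_inf X)
   (fun N => X i 0 + alpha ^+ N * vnorm_inf X)).
- apply: nearW => N; rewrite uE -ler_distl.
  rewrite addrAC subrr add0r normrN normrM ger0_norm ?exprn_ge0 //.
  by rewrite ler_wpM2l ?exprn_ge0.
- by rewrite -[X in _ --> X]subr0; apply: cvgB => //; exact: cvg_cst.
- by rewrite -[X in _ --> X]addr0; apply: cvgD => //; exact: cvg_cst.
Qed.

Lemma Jmu_fixed mu : Tm mu (Jm mu) = Jm mu.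
Proof.
rewrite Jmu_resolvent; set X := _ *m _.
rewrite /Tmu -[in LHS](mulKVmx (resolvent_unitmx mu) (rmu r mu)) -/X.
by rewrite mulmxBl mul1mx -scalemxAl subrK.
Qed.

(** The difference V - J^mu satisfies the hypothesis of [max_principle], as J^mu is fixed by T_mu.
    The next lemma is the mirror image. *)
Lemma le_Jmu_add mu (V : 'cV[R]_n) c : (forall i, V i 0 <= Tm mu V i 0 + c) ->
  forall i, V i 0 <= Jm mu i 0 + c / (1 - alpha).
Proof.
move=> HV i; rewrite -lerBlDl.
apply: (max_principle (mu := mu) (D := fun i => V i 0 - Jm mu i 0)) => {}i.
under eq_bigr do rewrite mulrBr.
have := HV i; rewrite sumrB -{1}[Jm mu]Jmu_fixed !TmuE /Qval; lra.
Qed.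

Lemma Jmu_le_add mu (V : 'cV[R]_n) c : (forall i, Tm mu V i 0 <= V i 0 + c) ->
  forall i, Jm mu i 0 <= V i 0 + c / (1 - alpha).
Proof.
move=> HV i; rewrite -lerBlDl.
apply: (max_principle (mu := mu) (D := fun i => Jm mu i 0 - V i 0)) => {}i.
under eq_bigr do rewrite mulrBr.
have := HV i; rewrite sumrB -{1}[Jm mu]Jmu_fixed !TmuE /Qval; lra.
Qed.

Lemma Jmu_bounds mu i : 0 <= Jm mu i 0 <= 1 / (1 - alpha).
Proof.
have T0 j : Tm mu 0 j 0 = r j (mu j).
  by rewrite TmuE /Qval big1 ?mulr0 ?addr0 // => k _; rewrite mxE mulr0.
apply/andP; split.
  have := @le_Jmu_add mu 0 0 _ i; rewrite mul0r addr0 mxE; apply=> j.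
  by rewrite T0 mxE addr0; case/andP: (r01 j (mu j)).
have := @Jmu_le_add mu 0 1 _ i; rewrite [X in X + _]mxE add0r; apply=> j.
by rewrite T0 mxE add0r; case/andP: (r01 j (mu j)).
Qed.

Lemma vnorm_inf_JmuB mu nu : vnorm_inf (Jm mu - Jm nu) <= 1 / (1 - alpha).
Proof.
have c0 : 0 <= 1 / (1 - alpha) by rewrite divr_ge0 // ltW.
apply: vnorm_infB_le => // i;
  by have := Jmu_bounds mu i; have := Jmu_bounds nu i; lra.
Qed.

(* A policy maximizing the sum of its values is optimal: the greedy policy with
   respect to its value is at least as good in every state, hence equally good. *)
Lemma optimal_policy : exists mu, T (Jm mu) = Jm mu.
Proof.
(* The maximum is taken over finite functions, which form a finite type. *)
pose nu := [arg max_(f > [ffun=> a0] : {ffun 'I_n -> A}) \sum_i Jm f i 0]%O.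
exists nu; pose J := Jm nu.
have /choice[g gP] i : exists a, T J i 0 = Qval J i a.
  by have [a Ta _] := Tbell_attained J i; exists a.
have TgJ i : Tm g J i 0 = T J i 0 by rewrite TmuE gP.
have JT i : J i 0 <= Tm g J i 0.
  by rewrite TgJ -{1}[J]Jmu_fixed Tmu_le_Tbell.
have Jg i : J i 0 <= Jm g i 0.
  have := @le_Jmu_add g J 0 _ i; rewrite mul0r addr0.
  by apply=> j; rewrite addr0.
have TJg i : T J i 0 <= Jm g i 0.
  rewrite -TgJ -[Jm g]Jmu_fixed; have := @Tmu_le_add g J (Jm g) 0 _ i.
  by rewrite mulr0 addr0; apply=> j; rewrite addr0.
have sums : \sum_i Jm g i 0 <= \sum_i J i 0.
  have -> : Jm g = Jm [ffun i => g i].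
    by congr Jmu; apply/funext => i; rewrite ffunE.
  by rewrite /J /nu; case: arg_maxP => // f _; exact.
have diff_ge0 i : true -> 0 <= Jm g i 0 - J i 0 by rewrite subr_ge0.
have diff_sum : \sum_i (Jm g i 0 - J i 0) = 0.
  by apply/eqP; rewrite eq_le sumr_ge0 // sumrB subr_le0 sums.
have eqJ i : Jm g i 0 = J i 0.
  by apply/eqP; rewrite -subr_eq0 (psumr_eq0P diff_ge0 diff_sum).
apply/colP => i; apply/eqP; rewrite eq_le -/J -[leRHS]eqJ TJg /=.
by rewrite -TgJ JT.
Qed.

(** A policy whose value J is fixed by T dominates every mu, because T_mu J <= T J = J; so the
    suprema defining J* are attained by one policy in all states. *)
Lemma Jstar_optimal : exists2 mu, Js = Jm mu & T Js = Js.
Proof.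
have [nu Tnu] := optimal_policy; exists nu => [|]; last first.
all: suff -> : Js = Jm nu by [].
all: have ub i mu : Jm mu i 0 <= Jm nu i 0.
1,3: by have := @Jmu_le_add mu (Jm nu) 0 _ i; rewrite mul0r addr0; apply=> j;
  rewrite addr0 -[in leRHS]Tnu Tmu_le_Tbell.
all: apply/colP => i; rewrite mxE; apply/eqP; rewrite eq_le; apply/andP; split.
1,3: by apply: ge_sup => [|_ [mu _ <-] //]; exists (Jm nu i 0), nu.
all: by apply: ub_le_sup; [exists (Jm nu i 0) => _ [mu _ <-] | exists nu].
Qed.

Lemma Jmu_le_Jstar mu i : Jm mu i 0 <= Js i 0.
Proof.
have [nu _ TJ] := Jstar_optimal.
have := @Jmu_le_add mu Js 0 _ i; rewrite mul0r addr0; apply=> j.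
by rewrite addr0 -[in leRHS]TJ Tmu_le_Tbell.
Qed.

Lemma iter_Tbell_Jstar h : iter h T Js = Js.
Proof. by have [_ _ TJ] := Jstar_optimal; elim: h => //= h ->. Qed.

Lemma vnorm_inf_JmuB_Jstar mu : vnorm_inf (Jm mu - Js) <= 1 / (1 - alpha).
Proof. by have [nu -> _] := Jstar_optimal; exact: vnorm_inf_JmuB. Qed.

(** Let V = T^(H-1) J^nu. Replacing J by J^nu costs alpha^H e on each side of the lookahead
    inequality, so T V <= T_mu V + c. As J^nu <= T J^nu, also V <= T V, hence V <= J^mu + c / (1 -
    alpha). *)
Lemma lookahead_improvement H (mu nu : 'I_n -> A) J eps : (0 < H)%N ->
  vnorm_inf (iter H T J - Tm mu (iter H.-1 T J)) <= eps ->
  vnorm_inf (Jm mu - Js) <= alpha ^+ H * vnorm_inf (Jm nu - Js)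
    + (2 * alpha ^+ H * vnorm_inf (Jm nu - J) + eps) / (1 - alpha).
Proof.
case: H => // h _; rewrite [h.+1.-1]/= iterS => Heps.
set e := vnorm_inf (Jm nu - J); set f := vnorm_inf (Jm nu - Js).
set c := 2 * _ * e + eps.
set V := iter h T (Jm nu); set W := iter h T J in Heps.
have VW i : V i 0 <= W i 0 + alpha ^+ h * e.
  by apply: iter_le_add => [|j]; [exact: Tbell_le_add | exact: coord_le_dist].
have WV i : W i 0 <= V i 0 + alpha ^+ h * e.
  apply: iter_le_add => [|j]; first exact: Tbell_le_add.
  by rewrite /e vnorm_infB; exact: coord_le_dist.
have TVmu i : T V i 0 <= Tm mu V i 0 + c.
  have := Tbell_le_add VW i; have := Tmu_le_add mu WV i.
  have := le_trans (coord_le_dist _ _ i) (lerD (lexx _) Heps).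
  by rewrite /c exprS; lra.
have VT i : V i 0 <= T V i 0.
  rewrite /V -iterS iterSr.
  have := @iter_le_add T h (Jm nu) (T (Jm nu)) 0 Tbell_le_add _ i.
  rewrite mulr0 addr0; apply=> j.
  by rewrite addr0 -{1}[Jm nu]Jmu_fixed Tmu_le_Tbell.
have VJ i : V i 0 <= Jm mu i 0 + c / (1 - alpha).
  by apply: le_Jmu_add => j; exact: le_trans (VT j) (TVmu j).
(* Passing from V to T V keeps the same constant, and makes the factor of f below alpha^H instead of
   alpha^(H-1). *)
have TVJ i : T V i 0 <= Jm mu i 0 + c / (1 - alpha).
  have := TVmu i; have := Tmu_le_add mu VJ i; rewrite Jmu_fixed.
  have cE : c / (1 - alpha) = alpha * (c / (1 - alpha)) + c.
    by field; rewrite gt_eqF.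
  by move: cE; lra.
have JsT i : Js i 0 <= T V i 0 + alpha ^+ h.+1 * f.
  rewrite -(iter_Tbell_Jstar h.+1) /V -iterS.
  apply: iter_le_add => [|j]; first exact: Tbell_le_add.
  by rewrite /f vnorm_infB; exact: coord_le_dist.
have c0 : 0 <= c.
  rewrite addr_ge0 ?(le_trans (vnorm_inf_ge0 _) Heps) //.
  by rewrite !mulr_ge0 ?exprn_ge0 ?vnorm_inf_ge0.
have b0 : 0 <= alpha ^+ h.+1 * f + c / (1 - alpha).
  by rewrite addr_ge0 ?mulr_ge0 ?invr_ge0 ?exprn_ge0 ?vnorm_inf_ge0
    ?(ltW alphaB_gt0).
apply: vnorm_infB_le => // i; last by have := TVJ i; have := JsT i; lra.
by have := Jmu_le_Jstar mu i; lra.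
Qed.

(** T_mu^m contracts towards J^mu, which leaves the distance from T^h J to J^mu. This is split at
    J*, towards which T^h contracts; any policy value is within 1 / (1 - alpha) of J*. *)
Lemma rollout_error m h (mu nu : 'I_n -> A) J :
  vnorm_inf (iter m (Tm mu) (iter h T J) - Jm mu) <=
  alpha ^+ (m + h) * vnorm_inf (Jm nu - J)
    + (alpha ^+ m + alpha ^+ (m + h)) / (1 - alpha).
Proof.
have -> : Jm mu = iter m (Tm mu) (Jm mu).
  by elim: m => //= m <-; rewrite Jmu_fixed.
apply: le_trans (iter_contraction _ _ _ (@Tmu_le_add mu)) _.
have -> : alpha ^+ (m + h) * vnorm_inf (Jm nu - J)
    + (alpha ^+ m + alpha ^+ (m + h)) / (1 - alpha)
  = alpha ^+ m * (alpha ^+ h * vnorm_inf (Jm nu - J)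
    + (1 + alpha ^+ h) / (1 - alpha)) by rewrite exprD; ring.
rewrite ler_wpM2l ?exprn_ge0 //.
apply: le_trans (vnorm_inf_dist_le _ Js _) _.
have := vnorm_inf_JmuB_Jstar mu; rewrite vnorm_infB => h1.
have := iter_contraction h J Js Tbell_le_add; rewrite iter_Tbell_Jstar.
have : vnorm_inf (J - Js) <= vnorm_inf (Jm nu - J) + 1 / (1 - alpha).
  apply: le_trans (vnorm_inf_dist_le _ (Jm nu) _) _.
  by rewrite vnorm_infB lerD2l vnorm_inf_JmuB_Jstar.
have ah : 0 <= alpha ^+ h by rewrite exprn_ge0.
by move=> /(ler_wpM2l ah); lra.
Qed.

End Values.

(** * Gradient descent for the least-squares fit *)

Section GradientDescent.
Variables (R : realType) (n d : nat) (Phi : 'M[R]_(n, d)).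

Lemma vnorm_inf_mulmx_dot y :
  vnorm_inf (Phi *m y) <= mxnorm_inf Phi * Num.sqrt (dot y y).
Proof.
apply: vnorm_inf_mulmx => [|j]; first exact: sqrtr_ge0.
by rewrite -sqrtr_sqr ler_wsqrtr // coord_sq_le_dot.
Qed.

Lemma dot_le_vnorm_inf m (v : 'cV[R]_m) : dot v v <= m%:R * vnorm_inf v ^+ 2.
Proof.
rewrite dotE -[m in m%:R]card_ord mulr_natl -sumr_const ler_sum // => i _.
rewrite -expr2 -(real_normK (num_real (v i 0))).
by rewrite lerXn2r ?nnegrE ?vnorm_inf_ge0 ?coord_le_vnorm_inf.
Qed.

(** The Rayleigh bound for - Phi^T Phi produces the least eigenvalue of Phi^T Phi, so the infimum in
    [sigma_min] is attained; injectivity of Phi makes it positive. *)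
Lemma sigma_minP : (0 < d)%N -> (forall x : 'cV_d, Phi *m x = 0 -> x = 0) ->
  0 < sigma_min Phi /\
  forall x, sigma_min Phi ^+ 2 * dot x x <= dot (Phi *m x) (Phi *m x).
Proof.
move=> d0 Phi_inj; set G := Phi^T *m Phi.
have Gsym : G^T = G by rewrite trmx_mul trmxK.
have NGsym : (- G)^T = - G by rewrite linearN /= Gsym.
have Gdot x : dot x (G *m x) = dot (Phi *m x) (Phi *m x).
  by rewrite dot_mulmxl mulmxA.
have [rho /eigenvalueP[v vG v0] Hrho] := rayleigh d0 NGsym.
have vGr : v *m G = - rho *: v by rewrite scaleNr -vG mulmxN opprK.
have Hl x : - rho * dot x x <= dot (Phi *m x) (Phi *m x).
  have := Hrho x; rewrite mulNmx -scaleN1r dotZr Gdot; lra.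
have eigE l (u : 'rV_d) : u *m G = l *: u ->
    l * dot u^T u^T = dot (Phi *m u^T) (Phi *m u^T).
  by move=> uG; rewrite -Gdot -dotZr -linearZ /= -uG trmx_mul Gsym.
have inf_eq : inf [set l | eigenvalue G l] = - rho.
  apply/eqP; rewrite eq_le; apply/andP; split.
    apply: ge_inf; last by apply/eigenvalueP; exists v.
    exists (- rho) => l /eigenvalueP[u uG u0].
    have ut0 : u^T != 0 by rewrite trmx_eq0.
    by rewrite -(ler_pM2r (dot_gt0 ut0)) (eigE _ _ uG).
  apply: lb_le_inf; first by exists (- rho); apply/eigenvalueP; exists v.
  move=> l /eigenvalueP[u uG u0].
  have ut0 : u^T != 0 by rewrite trmx_eq0.
  by rewrite -(ler_pM2r (dot_gt0 ut0)) (eigE _ _ uG).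
have rho_lt0 : 0 < - rho.
  have vt0 : v^T != 0 by rewrite trmx_eq0.
  rewrite -(pmulr_lgt0 _ (dot_gt0 vt0)) (eigE _ _ vGr) dot_gt0 //.
  by apply: contra vt0 => /eqP/Phi_inj ->.
rewrite /sigma_min -/G inf_eq sqrtr_gt0 sqr_sqrtr ?(ltW rho_lt0) //.
Qed.

Variable D : {set 'I_n}.
Hypothesis rankD : \rank (PhiD Phi D) = d.

Lemma PhiD_inj (x : 'cV_d) : PhiD Phi D *m x = 0 -> x = 0.
Proof.
move=> /(congr1 trmx); rewrite trmx_mul trmx0 => xP.
have PhiDfree : row_free (PhiD Phi D)^T by rewrite /row_free mxrank_tr rankD.
apply: trmx_inj; apply: (row_free_inj PhiDfree).
by rewrite /= xP trmx0 mul0mx.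
Qed.

Lemma Phi_inj (x : 'cV_d) : Phi *m x = 0 -> x = 0.
Proof. by move=> Px; apply: PhiD_inj; rewrite /PhiD -mulmxA Px mulmx0. Qed.

Lemma GramD_sym : (GramD Phi D)^T = GramD Phi D.
Proof. by rewrite trmx_mul trmxK. Qed.

Lemma GramD_unitmx : GramD Phi D \in unitmx.
Proof.
rewrite -unitmx_tr -row_free_unit; apply: inj_row_free => v.
move=> /(congr1 trmx); rewrite trmx_mul trmxK trmx0 -mulmxA => Gv.
have /dot_eq0/PhiD_inj : dot (PhiD Phi D *m v^T) (PhiD Phi D *m v^T) = 0.
  by rewrite dot_mulmxl Gv /dot mulmx0 mxE.
by move/(congr1 trmx); rewrite trmxK trmx0.
Qed.

Definition least_squares (Jh : 'cV[R]_n) : 'cV[R]_d :=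
  invmx (GramD Phi D) *m ((PhiD Phi D)^T *m (selmx R D *m Jh)).

Lemma mulmx_least_squares Jh : Phi *m least_squares Jh = Mproj Phi D *m Jh.
Proof. by rewrite /least_squares /Mproj !mulmxA. Qed.

(** The least-squares solution is the fixed point of the gradient step, so the error evolves
    linearly. *)
Lemma gd_step_error gamma Jh th :
  gd_step Phi gamma D Jh th - least_squares Jh =
  (1%:M - gamma *: GramD Phi D) *m (th - least_squares Jh).
Proof.
rewrite /gd_step -[(PhiD Phi D)^T *m _](mulKVmx GramD_unitmx).
rewrite -/(least_squares Jh).
by rewrite -mulmxBr mulmxBl mul1mx -scalemxAl addrAC.
Qed.

Lemma gd_error gamma a Jh th eta : 0 < gamma -> 0 <= a ->
  (forall l, eigenvalue (GramD Phi D) l -> `|1 - gamma * l| <= a) ->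
  Num.sqrt (dot (iter eta (gd_step Phi gamma D Jh) th - least_squares Jh)
                (iter eta (gd_step Phi gamma D Jh) th - least_squares Jh)) <=
  a ^+ eta * Num.sqrt (dot (th - least_squares Jh) (th - least_squares Jh)).
Proof.
move=> g0 a0 Ha; elim: eta => [|k IH]; first by rewrite mul1r.
rewrite iterS gd_step_error exprS -mulrA.
apply: le_trans (ler_wpM2l a0 IH); set y := _ - _.
rewrite -[a in leRHS](ger0_norm a0) -sqrtr_sqr.
rewrite -sqrtrM ?sqr_ge0 // ler_wsqrtr //.
apply: sym_contraction => [|l /eigenvalueP[v vB v0]].
  by rewrite linearB linearZ /= GramD_sym tr_scalar_mx.
(* An eigenvalue l of I - gamma G comes from the eigenvalue (1 - l) / gamma of G. *)
have -> : l = 1 - gamma * ((1 - l) / gamma) by field; rewrite gt_eqF.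
apply: Ha; apply/eigenvalueP; exists v => //.
apply: (scalerI (lt0r_neq0 g0)); rewrite scalerA mulrC divfK ?gt_eqF //.
by rewrite scalerBl scale1r -vB mulmxBr mulmx1 -scalemxAr subKr.
Qed.

(** The constant is the price of changing norms twice. With y the initial parameter error, |y|_2 <=
    |Phi y|_2 / sigma_min <= sqrt n |Phi y|_inf / sigma_min; after the descent, |Phi|_inf returns
    from the Euclidean to the max norm. *)
Lemma gd_fit_error gamma a Jh th eta : (0 < d)%N -> 0 < gamma -> 0 <= a ->
  (forall l, eigenvalue (GramD Phi D) l -> `|1 - gamma * l| <= a) ->
  vnorm_inf (Phi *m iter eta (gd_step Phi gamma D Jh) th - Mproj Phi D *m Jh) <=
  Num.sqrt n%:R * mxnorm_inf Phi / sigma_min Phi * a ^+ eta *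
    vnorm_inf (Phi *m th - Mproj Phi D *m Jh).
Proof.
move=> d0 g0 a0 Ha; have [s0 Hs] := sigma_minP d0 Phi_inj.
rewrite -mulmx_least_squares -!mulmxBr.
apply: le_trans (vnorm_inf_mulmx_dot _) _.
have := ler_wpM2l (mxnorm_inf_ge0 Phi) (gd_error Jh th eta g0 a0 Ha).
move=> /le_trans; apply.
set y := th - _; set v := Phi *m y.
have : Num.sqrt (dot y y) <= Num.sqrt n%:R * vnorm_inf v / sigma_min Phi.
  rewrite ler_pdivlMr // mulrC -[sigma_min Phi](ger0_norm (ltW s0)) -sqrtr_sqr.
  rewrite -sqrtrM ?sqr_ge0 // -[vnorm_inf v](ger0_norm (vnorm_inf_ge0 v)).
  rewrite -sqrtr_sqr -sqrtrM ?ler0n // ler_wsqrtr //.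
  exact: le_trans (Hs y) (dot_le_vnorm_inf _).
have c0 : 0 <= mxnorm_inf Phi * a ^+ eta.
  by rewrite mulr_ge0 ?mxnorm_inf_ge0 ?exprn_ge0.
move=> /(ler_wpM2l c0); lra.
Qed.

End GradientDescent.

(** * Real inequalities and recursions *)

Section RealLemmas.
Variable R : realType.

(** For positive a and x the hypothesis says x < (1 / a)^N. The cases a = 0 and x = 0, where the
    logarithms and the quotient take default values, are immediate because the product is 0. *)
Lemma expr_mul_lt1 (a x : R) N : (0 < N)%N -> 0 <= a < 1 -> 0 <= x ->
  ln x / ln (1 / a) < N%:R -> a ^+ N * x < 1.
Proof.
move=> N0 /andP[]; rewrite le_eqVlt => /predU1P[<- _ _ _|a0 a1].
  by rewrite expr0n gtn_eqF // mul0r.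
rewrite le_eqVlt => /predU1P[<-|x0]; first by rewrite mulr0.
have ia : 1 < 1 / a by rewrite ltr_pdivlMr // mul1r.
have ia0 : 0 < 1 / a by apply: lt_trans ia.
rewrite ltr_pdivrMr ?ln_gt0 // mulr_natl -lnXn // ltr_ln ?posrE ?exprn_gt0 //.
by rewrite expr_div_n expr1n ltr_pdivlMr ?exprn_gt0 // mulrC.
Qed.

Lemma affine_recursion (e : nat -> R) b t : 0 <= b < 1 -> 0 <= t ->
  (forall k, e k.+1 <= b * e k + t) ->
  forall k, e k <= b ^+ k * e 0 + t / (1 - b).
Proof.
move=> /andP[b0 b1] t0 He; have ib : 0 < 1 - b by rewrite subr_gt0.
elim=> [|k IH]; first by rewrite mul1r lerDl divr_ge0 // ltW.
have E : t / (1 - b) = b * (t / (1 - b)) + t by field; rewrite gt_eqF.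
apply: le_trans (He k) _; have := ler_wpM2l b0 IH; rewrite exprS.
by move: E; lra.
Qed.

Lemma coupled_recursion (e f : nat -> R) a b q s t :
  0 <= a < 1 -> 0 <= b < 1 -> 0 <= q -> 0 <= s -> 0 <= t -> 0 <= e 0 ->
  (forall k, e k.+1 <= b * e k + t) ->
  (forall k, f k.+1 <= a * f k + q * e k + s) ->
  forall k, f k <= a ^+ k * f 0 + q * e 0 * k%:R * (Num.max a b) ^+ k.-1
                   + (q * (t / (1 - b)) + s) / (1 - a).
Proof.
move=> /andP[a0 a1] b01 q0 s0 t0 e0 He Hf.
have /andP[b0 b1] := b01; have ib : 0 < 1 - b by rewrite subr_gt0.
have ia : 0 < 1 - a by rewrite subr_gt0.
set u := t / (1 - b); set Z := (_ + s) / _; set M := Num.max a b.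
have aM : a <= M by rewrite le_max lexx.
have bM : b <= M by rewrite le_max lexx orbT.
have u0 : 0 <= u by rewrite divr_ge0 // ltW.
have Z0 : 0 <= Z by rewrite divr_ge0 ?(ltW ia) // addr_ge0 // mulr_ge0.
have ZE : Z = a * Z + (q * u + s) by rewrite /Z; field; rewrite gt_eqF.
elim=> [|k IH]; first by rewrite mul1r mulr0 mul0r addr0 lerDl.
(* Each step of the recursion adds one more product of k factors a or b; bounding all of them by M^k
   yields the factor k. For k = 0 the truncated exponent is harmless, being multiplied by 0. *)
have step : a * (k%:R * M ^+ k.-1) + b ^+ k <= k.+1%:R * M ^+ k.
  rewrite -natr1 mulrDl mul1r lerD ?lerXn2r ?nnegrE ?(le_trans a0 aM) //.
  case: k {IH} => [|k]; first by rewrite !mul0r mulr0.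
  rewrite mulrCA ler_wpM2l // exprS ler_wpM2r // exprn_ge0 //.
  exact: le_trans aM.
apply: le_trans (Hf k) _.
have := ler_wpM2l a0 IH; have := ler_wpM2l q0 (affine_recursion b01 t0 He k).
have := ler_wpM2l (mulr_ge0 q0 e0) step.
by rewrite -/u exprS; move: ZE; lra.
Qed.

End RealLemmas.

(** * The error bound for the algorithm *)

Theorem theorem2 (R : realType) (n d : nat) (A : finType)
  (P : A -> 'M[R]_n) (r : 'I_n -> A -> R) (alpha : R)
  (Phi : 'M[R]_(n, d))
  (m H eta : nat) (gamma epsLA epsPE : R)
  (D : nat -> {set 'I_n})
  (theta : nat -> 'cV[R]_d) (mu : nat -> ('I_n -> A)) (w : nat -> 'cV[R]_n) :
  (* MDP *)
  (0 < n)%N -> (0 < d)%N ->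
  (forall a i j, 0 <= P a i j) ->
  (forall a i, \sum_j P a i j = 1) ->
  (forall i a, 0 <= r i a <= 1) ->
  0 < alpha < 1 ->
  (* parameters *)
  (1 <= m)%N -> (1 <= H)%N -> (1 <= eta)%N -> 0 < gamma ->
  0 <= epsLA -> 0 <= epsPE ->
  (forall k, \rank (PhiD Phi (D k)) = d) ->
  (* the algorithm *)
  (forall k, vnorm_inf (iter H (Tbell P r alpha) (Phi *m theta k)
               - Tmu P r alpha (mu k.+1)
                   (iter H.-1 (Tbell P r alpha) (Phi *m theta k))) <= epsLA) ->
  (forall k i, i \notin D k -> w k.+1 i 0 = 0) ->
  (forall k, vnorm_inf (w k.+1) <= epsPE) ->
  (forall k, theta k.+1 =
     iter eta
       (gd_step Phi gamma (D k)
          (iter m (Tmu P r alpha (mu k.+1))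
             (iter H.-1 (Tbell P r alpha) (Phi *m theta k)) + w k.+1))
       (theta k)) ->
  (* hypotheses of the theorem *)
  (alpha_GD Phi gamma D < 1%:E)%E ->
  (delta_FV Phi D < +oo)%E ->
  let dFV := fine (delta_FV Phi D) in
  let dapp := fine (delta_app Phi P r alpha D) in
  let aGD := fine (alpha_GD Phi gamma D) in
  let c := Num.sqrt n%:R * mxnorm_inf Phi / sigma_min Phi in
  (m + H - 1)%:R > ln (2 * dFV) / ln (1 / alpha) ->
  eta%:R > ln (3 * c) / ln (1 / aGD) ->
  let beta := alpha ^+ (m + H - 1) * dFV
              + c * aGD ^+ eta * (alpha ^+ (m + H - 1) * dFV + 1) in
  let tau := (1 + c * aGD ^+ eta) *
               ((alpha ^+ m + alpha ^+ (m + H - 1)) / (1 - alpha) * dFV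
                + dapp + dFV * epsPE)
             + c * aGD ^+ eta / (1 - alpha) in
  beta < 1 /\
  forall k, (1 <= k)%N ->
    vnorm_inf (Jmu P r alpha (mu k) - Jstar P r alpha)
    <= alpha ^+ (k * H) / (1 - alpha)
       + 2 * alpha ^+ H * vnorm_inf (Jmu P r alpha (mu 0) - Phi *m theta 0)
           / (1 - alpha) * k%:R * (Num.max (alpha ^+ H) beta) ^+ k.-1
       + (2 * alpha ^+ H * (tau / (1 - beta)) + epsLA)
           / ((1 - alpha ^+ H) * (1 - alpha)).
Proof.
move=> n0 d0 P_ge0 P_sum1 r01 alpha01 m0 H0 eta0 gamma0 epsLA0 epsPE0 rankD.
move=> lookahead _ noise thetaE aGD_lt1 dFV_fin dFV dapp aGD c HmH Heta beta tau.
have /andP[alpha0 alpha1] := alpha01.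
have a0 : A := mu 0 (Ordinal n0).
have ialpha : 0 < 1 - alpha by rewrite subr_gt0.
have v0 : 0 <= 1 / (1 - alpha) by rewrite divr_ge0 // ltW.
have [sigma0 _] := sigma_minP d0 (Phi_inj (rankD 0%N)).
have c0 : 0 <= c.
  by rewrite divr_ge0 ?(ltW sigma0) // mulr_ge0 ?sqrtr_ge0 ?mxnorm_inf_ge0.
(* [fine] is faithful only on finite values, so each extended supremum is first shown finite; a
   member of the set excludes -oo. *)
have dFVE : delta_FV Phi D = dFV%:E.
  rewrite fineK // fin_real // dFV_fin andbT.
  apply: (@lt_le_trans _ _ (mxnorm_inf (Mproj Phi (D 0)))%:E).
    exact: ltNyr.
  by apply: ereal_sup_ubound; exists 0%N.
have M_le k : mxnorm_inf (Mproj Phi (D k)) <= dFV.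
  by rewrite -lee_fin -dFVE; apply: ereal_sup_ubound; exists k.
have dFV0 : 0 <= dFV := le_trans (mxnorm_inf_ge0 _) (M_le 0%N).
have Mv_le k (v : 'cV_n) : vnorm_inf (Mproj Phi (D k) *m v) <= dFV * vnorm_inf v.
  apply: le_trans (ler_wpM2r (vnorm_inf_ge0 v) (M_le k)).
  by apply: vnorm_inf_mulmx; [exact: vnorm_inf_ge0 | exact: coord_le_vnorm_inf].
have J_le nu : vnorm_inf (Jmu P r alpha nu) <= 1 / (1 - alpha).
  apply: vnorm_inf_le => // i.
  have /andP[h1 h2] := Jmu_bounds P_ge0 P_sum1 r01 alpha01 nu i.
  by rewrite ger0_norm.
have dappE : delta_app Phi P r alpha D = dapp%:E.
  rewrite fineK // fin_real //; apply/andP; split.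
    apply: (@lt_le_trans _ _ (vnorm_inf (Mproj Phi (D 0) *m Jmu P r alpha (mu 0)
                              - Jmu P r alpha (mu 0)))%:E); first by rewrite ltNyr.
    by apply: ereal_sup_ubound; exists (0%N, mu 0).
  (* Finiteness of delta_app follows from that of delta_FV, since policy values are at most 1 / (1 -
     alpha). *)
  apply: (@le_lt_trans _ _ (dFV * (1 / (1 - alpha)) + 1 / (1 - alpha))%:E).
    apply: ge_ereal_sup => _ [[k nu] _ <-]; rewrite lee_fin /=.
    apply: le_trans (ler_vnorm_infD _ _) _; rewrite vnorm_infN lerD //.
    by apply: le_trans (Mv_le _ _) _; rewrite ler_wpM2l.
  exact: ltry.
have app_le k nu : vnorm_inf (Mproj Phi (D k) *m Jmu P r alpha nu
                              - Jmu P r alpha nu) <= dapp.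
  by rewrite -lee_fin -dappE; apply: ereal_sup_ubound; exists (k, nu).
have dapp0 : 0 <= dapp := le_trans (vnorm_inf_ge0 _) (app_le 0%N (mu 0)).
(* Some eigenvalue is needed for the supremum alpha_GD to range over a nonempty set. *)
have [l0 l0P _] := rayleigh d0 (GramD_sym Phi (D 0)).
have aGDE : alpha_GD Phi gamma D = aGD%:E.
  rewrite fineK // fin_real //; apply/andP; split; last exact: lt_trans (ltry 1).
  apply: (@lt_le_trans _ _ (`|1 - gamma * l0|)%:E); first by rewrite ltNyr.
  by apply: ereal_sup_ubound; exists l0 => //; exists 0%N.
have aGD_le k l : eigenvalue (GramD Phi (D k)) l -> `|1 - gamma * l| <= aGD.
  move=> lP; rewrite -lee_fin -aGDE; apply: ereal_sup_ubound.
  by exists l => //; exists k.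
have aGD0 : 0 <= aGD := le_trans (normr_ge0 _) (aGD_le 0%N l0 l0P).
have aGD1 : aGD < 1 by rewrite -lte_fin -aGDE.
set N := (m + H - 1)%N in HmH beta tau *.
have N0 : (0 < N)%N by rewrite subn_gt0 (leq_add m0 H0).
set x := alpha ^+ N * dFV in beta *.
set y := c * aGD ^+ eta in beta tau *.
have x_lt : 2 * x < 1.
  rewrite /x mulrCA; apply: expr_mul_lt1 => //; last by rewrite mulr_ge0.
  by rewrite ltW.
have y_lt : 3 * y < 1.
  rewrite /y mulrA mulrC; apply: expr_mul_lt1 => //; last by rewrite mulr_ge0.
  by rewrite aGD0.
have x0 : 0 <= x by rewrite mulr_ge0 // exprn_ge0 // ltW.
have y0 : 0 <= y by rewrite mulr_ge0 // exprn_ge0.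
(* From x < 1/2 and y < 1/3, beta = x + y (x + 1) < 1/2 + (1/3) (3/2) = 1. *)
have beta_lt1 : beta < 1.
  have : y * x <= y * 2^-1 by rewrite ler_wpM2l //; lra.
  by rewrite /beta; lra.
split=> // k _.
have beta0 : 0 <= beta by rewrite addr_ge0 // mulr_ge0 // addr_ge0.
pose z := (alpha ^+ m + alpha ^+ N) / (1 - alpha) * dFV + dapp + dFV * epsPE.
have z0 : 0 <= z.
  have ge0 : 0 <= (alpha ^+ m + alpha ^+ N) / (1 - alpha).
    by rewrite divr_ge0 ?(ltW ialpha) // addr_ge0 // exprn_ge0 // ltW.
  apply: addr_ge0; last exact: mulr_ge0.
  by apply: addr_ge0 => //; exact: mulr_ge0.
have tauE : tau = (1 + y) * z + y / (1 - alpha) by [].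
have tau0 : 0 <= tau.
  have y1 : 0 <= 1 + y by exact: addr_ge0.
  rewrite tauE; apply: addr_ge0; first exact: mulr_ge0.
  by apply: divr_ge0 => //; exact: ltW.
pose J k := Phi *m theta k.
pose e k := vnorm_inf (Jmu P r alpha (mu k) - J k).
pose f k := vnorm_inf (Jmu P r alpha (mu k) - Jstar P r alpha).
have e_rec k' : e k'.+1 <= beta * e k' + tau.
  pose Jh := iter m (Tmu P r alpha (mu k'.+1))
    (iter H.-1 (Tbell P r alpha) (J k')) + w k'.+1.
  pose Mk := Mproj Phi (D k').
  (* The three summands are the projected rollout error, the approximation error of the value, and
     the projected noise. *)
  have fit : vnorm_inf (Mk *m Jh - Jmu P r alpha (mu k'.+1)) <= x * e k' + z.
    have -> : Mk *m Jh - Jmu P r alpha (mu k'.+1) =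
        Mk *m (iter m (Tmu P r alpha (mu k'.+1))
                 (iter H.-1 (Tbell P r alpha) (J k'))
               - Jmu P r alpha (mu k'.+1))
        + (Mk *m Jmu P r alpha (mu k'.+1) - Jmu P r alpha (mu k'.+1))
        + Mk *m w k'.+1.
      by rewrite /Jh mulmxDr mulmxBr addrA subrK addrAC.
    apply: le_trans (ler_vnorm_infD _ _) _.
    apply: le_trans (lerD (ler_vnorm_infD _ _) (Mv_le _ _)) _.
    have := ler_wpM2l dFV0 (rollout_error a0 P_ge0 P_sum1 r01 alpha01 m H.-1
      (mu k'.+1) (mu k') (J k')).
    have -> : (m + H.-1 = N)%N by rewrite -subn1 addnBA.
    have := Mv_le k' (iter m (Tmu P r alpha (mu k'.+1))
      (iter H.-1 (Tbell P r alpha) (J k')) - Jmu P r alpha (mu k'.+1)).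
    have := app_le k' (mu k'.+1); have := ler_wpM2l dFV0 (noise k').
    by rewrite -/(e k') /z /x -/Mk; lra.
  have gd := gd_fit_error (rankD k') Jh (theta k') eta d0 gamma0 aGD0 (aGD_le k').
  rewrite -thetaE -/(J k'.+1) -/Mk -/c -/y -/(J k') in gd.
  (* The starting distance of the descent is split at the values of the old and new policies, which
     differ by at most 1 / (1 - alpha). Weighted by y and added to [fit], it gives exactly beta e +
     tau. *)
  have far : vnorm_inf (J k' - Mk *m Jh) <= e k' + 1 / (1 - alpha) + (x * e k' + z).
    apply: le_trans (vnorm_inf_dist_le _ (Jmu P r alpha (mu k'.+1)) _) _.
    rewrite [X in _ + X <= _]vnorm_infB lerD //.
    apply: le_trans (vnorm_inf_dist_le _ (Jmu P r alpha (mu k')) _) _.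
    by rewrite vnorm_infB lerD2l; exact: vnorm_inf_JmuB.
  apply: le_trans (vnorm_inf_dist_le _ (Mk *m Jh) _) _.
  rewrite vnorm_infB [X in _ + X <= _]vnorm_infB.
  have := ler_wpM2l y0 far; move: gd fit; rewrite tauE /beta; lra.
have f_rec k' : f k'.+1 <= alpha ^+ H * f k'
    + 2 * alpha ^+ H / (1 - alpha) * e k' + epsLA / (1 - alpha).
  have := lookahead_improvement a0 P_ge0 P_sum1 alpha01 (mu k') H0 (lookahead k').
  by rewrite -/(J k') -/(e k') -/(f k') -/(f k'.+1); lra.
have aH0 : 0 <= alpha ^+ H by rewrite exprn_ge0 // ltW.
have aH1 : alpha ^+ H < 1 by rewrite exprn_ilt1 -?lt0n // ltW.
have aH01 : 0 <= alpha ^+ H < 1 by rewrite aH0.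
have beta01 : 0 <= beta < 1 by rewrite beta0.
have q0 : 0 <= 2 * alpha ^+ H / (1 - alpha).
  by rewrite divr_ge0 ?(ltW ialpha) // mulr_ge0.
have s0 : 0 <= epsLA / (1 - alpha) by rewrite divr_ge0 // ltW.
have := coupled_recursion aH01 beta01 q0 s0 tau0 (vnorm_inf_ge0 _) e_rec f_rec k.
move=> /le_trans; apply; rewrite mulnC exprM.
apply: lerD.
  (* The first term uses f_0 <= 1 / (1 - alpha); the other two agree with the claim up to
     rearrangement. *)
  apply: lerD; last by rewrite /e /J mulrAC -!mulrA; lra.
  rewrite ler_wpM2l ?exprn_ge0 ?(ltW alpha0) // -div1r.
  exact: (vnorm_inf_JmuB_Jstar a0 P_ge0 P_sum1 r01 alpha01).
rewrite le_eqVlt; apply/orP; left; apply/eqP; field.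
by rewrite !gt_eqF // subr_gt0.
Qed.
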